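(* Let $E$ be the set of scaled extremals in a max cone $K$ in $\mathbb{R}^n_+$. Let $S\subseteq K$ consist of scaled elements. Then the following are equivalent: (1) $S$ is a minimal (with respect to inclusion) set of generators for $K$. (2) $S=E$ and $S$ generates $K$. (3) $S$ is a basis for $K$.
   Context: $\mathbb{R}^n_+$ is the set of vectors with nonnegative real entries; $a\oplus b=\max(a,b)$, extended componentwise to vectors. A max cone is a subset of $\mathbb{R}^n_+$ closed under $\oplus$ and under multiplication by nonnegative reals. $\operatorname{span}(S)$ is the set of all max combinations $\bigoplus_{x\in S}\lambda_x x$ with $\lambda_x\ge 0$ and only finitely many $\lambda_x\neq 0$; $\operatorname{span}(\emptyset)=\{0\}$. $S$ generates $K$ (is a set of generators for $K$) if $\operatorname{span}(S)=K$. An element $u\in K$ is an extremal in $K$ if $u=v\oplus w$ with $v,w\in K$ implies $u=v$ or $u=w$. Fix an arbitrary norm $\|\cdot\|$ on $\mathbb{R}^n$; a vector $x\in\mathbb{R}^n_+$ is scaled if $\|x\|=1$. A set $S$ is dependent if some $x\in S$ is a max combination of $S\setminus\{x\}$ (i.e. $x\in\operatorname{span}(S\setminus\{x\})$), and independent otherwise. A basis for $K$ is an independent set of generators for $K$. *)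

(* Defs.v *)
From mathcomp Require Import all_boot all_order all_algebra.
From mathcomp Require Import boolp classical_sets functions cardinality fsbigop reals.

Set Implicit Arguments.
Unset Strict Implicit.
Unset Printing Implicit Defensive.

Import Order.TTheory GRing.Theory Num.Theory.

Local Open Scope classical_set_scope.
Local Open Scope ring_scope.

Definition nonneg_orthant (R : realType) (n : nat) : set 'rV[R]_n :=
  [set x | forall i, 0 <= x 0 i].

Definition vmax (R : realType) (n : nat) (u v : 'rV[R]_n) : 'rV[R]_n :=
  map2_mx Num.max u v.

(* ['rV[R]_n] carries a canonical norm in the library, so an arbitrary norm is
   a function satisfying the norm axioms rather than a structure instance. *)
Record is_norm (R : realType) (n : nat) (N : 'rV[R]_n -> R) : Prop := IsNorm {
  is_norm_ge0 : forall x, 0 <= N x ;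
  is_norm_eq0 : forall x, N x = 0 -> x = 0 ;
  is_normZ : forall a x, N (a *: x) = `|a| * N x ;
  is_normD : forall x y, N (x + y) <= N x + N y }.

Definition max_cone (R : realType) (n : nat) (K : set 'rV[R]_n) : Prop :=
  [/\ K `<=` @nonneg_orthant R n,
      forall u v, K u -> K v -> K (vmax u v)
    & forall (a : R) u, 0 <= a -> K u -> K (a *: u)].

(* The neutral element 0 of [vmax] is only neutral on the nonnegative orthant;
   [max_span S] is meant for [S] contained in it. *)
Definition max_span (R : realType) (n : nat) (S : set 'rV[R]_n) :
    set 'rV[R]_n :=
  [set y | exists lambda : 'rV[R]_n -> R,
    [/\ forall x, S x -> 0 <= lambda x,
        finite_set [set x | S x /\ lambda x <> 0]
      & y = \big[@vmax R n/0]_(x \in S) (lambda x *: x)]].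

Definition generates (R : realType) (n : nat) (S K : set 'rV[R]_n) : Prop :=
  max_span S = K.

Definition minimal_generators (R : realType) (n : nat) (S K : set 'rV[R]_n) :
    Prop :=
  generates S K /\ forall T, T `<=` S -> generates T K -> T = S.

Definition extremal (R : realType) (n : nat) (K : set 'rV[R]_n)
    (u : 'rV[R]_n) : Prop :=
  K u /\ forall v w, K v -> K w -> u = vmax v w -> u = v \/ u = w.

Definition scaled (R : realType) (n : nat) (N : 'rV[R]_n -> R)
    (x : 'rV[R]_n) : Prop :=
  nonneg_orthant x /\ N x = 1.

Definition scaled_extremals (R : realType) (n : nat) (N : 'rV[R]_n -> R)
    (K : set 'rV[R]_n) : set 'rV[R]_n :=
  [set u | extremal K u /\ scaled N u].

Definition dependent (R : realType) (n : nat) (S : set 'rV[R]_n) : Prop :=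
  exists2 x, S x & max_span (S `\ x) x.

Definition independent (R : realType) (n : nat) (S : set 'rV[R]_n) : Prop :=
  ~ dependent S.

Definition max_basis (R : realType) (n : nat) (S K : set 'rV[R]_n) : Prop :=
  independent S /\ generates S K.

(* Main.v *)
Require Import Defs.
From mathcomp Require Import all_boot all_order all_algebra.
From mathcomp Require Import boolp classical_sets functions cardinality fsbigop reals.
From mathcomp Require Import finmap.

Import Order.TTheory GRing.Theory Num.Theory.

Local Open Scope classical_set_scope.
Local Open Scope ring_scope.

(** A max combination is the componentwise least upper bound of its terms in
    the nonnegative orthant.  If an extremal [u] is a max combination of [T],
    then [u] is one of the terms, hence a multiple of an element of [T]; among
    scaled vectors this multiple is [1].  So every generating set of scaled
    vectors contains all scaled extremals, and the scaled extremals are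
    independent.  Conversely, let [S] be a basis, [x] in [S] and
    [x = vmax v w]; write [v = vmax (a x) v'] and [w = vmax (b x) w'] with
    [v'] and [w'] in the span of the other elements of [S].  If [a] or [b]
    equals [1] then [v = x] or [w = x]; otherwise the terms [a x] and [b x] lie
    strictly below [x] on its support and can be dropped, which makes [x] a max
    combination of the other elements of [S]. *)

(** * Componentwise order and maximum on the orthant *)

Definition vle {R : realType} {n : nat} (u v : 'rV[R]_n) : Prop :=
  forall i, u 0 i <= v 0 i.

Lemma vle_anti {R : realType} {n : nat} {u v : 'rV[R]_n} :
  vle u v -> vle v u -> u = v.
Proof.
by move=> uv vu; apply/rowP => i; apply/le_anti; rewrite uv vu.
Qed.

Lemma vmaxE {R : realType} {n : nat} (u v : 'rV[R]_n) i :
  vmax u v 0 i = Num.max (u 0 i) (v 0 i).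
Proof. by rewrite mxE. Qed.

Lemma vmax_le {R : realType} {n : nat} (u v z : 'rV[R]_n) :
  vle (vmax u v) z <-> vle u z /\ vle v z.
Proof.
split=> [uvz|[uz vz] i]; last by rewrite vmaxE ge_max uz vz.
by split=> i; move: (uvz i); rewrite vmaxE ge_max => /andP[].
Qed.

Lemma vmax_ge0 {R : realType} {n : nat} (u v : 'rV[R]_n) :
  nonneg_orthant u -> nonneg_orthant (vmax u v).
Proof. by move=> u0 i; rewrite vmaxE le_max u0. Qed.

Lemma vmaxr0 {R : realType} {n : nat} (u : 'rV[R]_n) :
  nonneg_orthant u -> vmax u 0 = u.
Proof. by move=> u0; apply/rowP => i; rewrite vmaxE mxE; exact: max_l. Qed.

Lemma vmaxCA4 {R : realType} {n : nat} (u v w t : 'rV[R]_n) :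
  vmax (vmax u v) (vmax w t) = vmax (vmax u w) (vmax v t).
Proof. by apply/rowP => i; rewrite !vmaxE maxACA. Qed.

Lemma scaler_vmax {R : realType} {n : nat} (a : R) (u v : 'rV[R]_n) :
  0 <= a -> a *: vmax u v = vmax (a *: u) (a *: v).
Proof. by move=> a0; apply/rowP => i; rewrite !mxE maxr_pMr. Qed.

Lemma scale_max {R : realType} {n : nat} (a b : R) (x : 'rV[R]_n) :
  nonneg_orthant x -> Num.max a b *: x = vmax (a *: x) (b *: x).
Proof. by move=> x0; apply/rowP => i; rewrite !mxE maxr_pMl. Qed.

Lemma orthant0 {R : realType} {n : nat} : nonneg_orthant (0 : 'rV[R]_n).
Proof. by move=> i; rewrite mxE. Qed.

Lemma vle0 {R : realType} {n : nat} (z : 'rV[R]_n) :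
  nonneg_orthant z -> vle 0 z.
Proof. by move=> z0 i; rewrite mxE. Qed.

Lemma scale_ge0 {R : realType} {n : nat} (a : R) (x : 'rV[R]_n) :
  0 <= a -> nonneg_orthant x -> nonneg_orthant (a *: x).
Proof. by move=> a0 x0 i; rewrite mxE mulr_ge0. Qed.

(** * Max combinations and closure properties of spans *)

Lemma max_span_ind {R : realType} {n : nat} (T P : set 'rV[R]_n) :
  P 0 -> (forall u v, P u -> P v -> P (vmax u v)) ->
  (forall a x, 0 <= a -> T x -> P (a *: x)) -> max_span T `<=` P.
Proof.
move=> P0 PU PZ _ [lam [lam0 fin ->]]; rewrite big_seq.
(* The operator folds over the support of its terms, a finite subset of [T]; for an infinite support
   the list is empty. *)
elim/big_ind: _ => // x; case: finite_supportP => //= X XT _ _ xX.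
by apply: PZ; [apply/lam0/XT|apply/XT].
Qed.

Lemma vle_bigvmax {R : realType} {n : nat} {I : eqType} (s : seq I)
    (f : I -> 'rV[R]_n) x : x \in s -> vle (f x) (\big[@vmax R n/0]_(y <- s) f y).
Proof.
elim: s => // y s IHs; rewrite inE big_cons => /orP[/eqP-> | /IHs xs] i.
  by rewrite vmaxE le_max lexx.
by rewrite vmaxE le_max xs orbT.
Qed.

Lemma fsbig_vmax_le {R : realType} {n : nat} (T : set 'rV[R]_n)
    (lam : 'rV[R]_n -> R) (z : 'rV[R]_n) :
  finite_set [set x | T x /\ lam x <> 0] -> nonneg_orthant z ->
  vle (\big[@vmax R n/0]_(x \in T) (lam x *: x)) z <->
  (forall x, T x -> vle (lam x *: x) z).
Proof.
move=> fin z0; case: finite_supportP => [inf|X XT X0 _].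
  (* A nonzero term has a nonzero coefficient, so the support of the terms is finite and the default
     value [0] of the operator is excluded. *)
  case: inf; apply: sub_finite_set fin => x [Tx /= lx]; split=> // l0.
  by apply: lx; rewrite l0 scale0r.
split=> [bz x Tx|Tz]; last first.
  rewrite big_seq; elim/big_ind: _ => [||x /XT/Tz//]; first exact: vle0.
  by move=> u v uz vz; apply/vmax_le.
have [xX|xX] := boolP (x \in X).
  by move=> i; apply: le_trans (bz i); exact: (vle_bigvmax _ (fun y => lam y *: y)).
by rewrite X0//; exact: vle0.
Qed.

Lemma max_span_ge0 {R : realType} {n : nat} {T : set 'rV[R]_n} :
  T `<=` @nonneg_orthant R n -> max_span T `<=` @nonneg_orthant R n.
Proof.
move=> T0; apply: max_span_ind => [|u v u0 v0|a x a0 /T0]; last exact: scale_ge0.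
  exact: orthant0.
exact: vmax_ge0.
Qed.

(** A least upper bound is unique by antisymmetry, so membership in a span needs only coefficients
    and a comparison of upper bounds, with no manipulation of big operators. *)
Lemma max_span_lub {R : realType} {n : nat} (T : set 'rV[R]_n)
    (lam : 'rV[R]_n -> R) (y : 'rV[R]_n) :
  T `<=` @nonneg_orthant R n -> (forall x, T x -> 0 <= lam x) ->
  finite_set [set x | T x /\ lam x <> 0] -> nonneg_orthant y ->
  (forall z, nonneg_orthant z ->
     vle y z <-> (forall x, T x -> vle (lam x *: x) z)) ->
  max_span T y.
Proof.
move=> T0 lam0 fin y0 ylub; exists lam; split=> //.
have b0 : nonneg_orthant (\big[@vmax R n/0]_(x \in T) (lam x *: x)).
  by apply: (max_span_ge0 T0); exists lam.
apply: vle_anti.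
  by apply/ylub => //; apply/fsbig_vmax_le.
by apply/fsbig_vmax_le => //; apply/ylub.
Qed.

Lemma max_span_scale {R : realType} {n : nat} (T : set 'rV[R]_n) a x :
  T `<=` @nonneg_orthant R n -> 0 <= a -> T x -> max_span T (a *: x).
Proof.
move=> T0 a0 Tx; apply: (@max_span_lub _ _ _ (fun y => if y == x then a else 0)) => //.
- by move=> y _; case: ifP.
- apply: sub_finite_set (finite_set1 x) => y [_] /=.
  by case: eqP.
- by apply: scale_ge0 => //; exact: T0.
move=> z z0; split=> [xz y Ty|/(_ x Tx)]; last by rewrite eqxx.
case: eqP => [->//|_]; by rewrite scale0r; exact: vle0.
Qed.

Lemma max_span0 {R : realType} {n : nat} (T : set 'rV[R]_n) :
  T `<=` @nonneg_orthant R n -> max_span T 0.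
Proof.
move=> T0; apply: (@max_span_lub _ _ _ (fun=> 0)) => //.
- by apply: sub_finite_set (@finite_set0 _) => y [_].
- exact: orthant0.
by move=> z z0; split=> [_ x _|_]; rewrite ?scale0r; exact: vle0.
Qed.

(** The coefficients of the two combinations are merged by their pointwise maximum, whose support
    lies in the union of the two supports. *)
Lemma max_span_vmax {R : realType} {n : nat} {T : set 'rV[R]_n} {u v} :
  T `<=` @nonneg_orthant R n -> max_span T u -> max_span T v ->
  max_span T (vmax u v).
Proof.
move=> T0 su sv.
have uv0 : nonneg_orthant (vmax u v) by apply/vmax_ge0/(max_span_ge0 T0).
case: su sv uv0 => [lam [lam0 lfin ->]] [mu [mu0 mfin ->]] uv0.
apply: (@max_span_lub _ _ _ (fun x => Num.max (lam x) (mu x))) => //.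
- by move=> x Tx; rewrite le_max lam0.
- have : finite_set ([set x | T x /\ lam x <> 0] `|` [set x | T x /\ mu x <> 0]).
    by rewrite finite_setU.
  apply: sub_finite_set => x [Tx /= lmx].
  have [l0|l0] := eqVneq (lam x) 0; last by left; split=> //; apply/eqP.
  by right; split=> // m0; apply: lmx; rewrite l0 m0 maxxx.
move=> z z0; rewrite vmax_le !fsbig_vmax_le//; split=> [[lz mz] x Tx|lmz].
  by rewrite scale_max; [apply/vmax_le; split; [exact: lz|exact: mz]|exact: T0].
by split=> x Tx; move: (lmz x Tx); rewrite scale_max; [case/vmax_le| exact: T0
  |case/vmax_le| exact: T0].
Qed.

Lemma max_span_sub {R : realType} {n : nat} (S T : set 'rV[R]_n) :
  T `<=` @nonneg_orthant R n -> S `<=` max_span T -> max_span S `<=` max_span T.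
Proof.
move=> T0 ST; apply: max_span_ind => [|u v|a x a0 /ST].
- exact: max_span0.
- exact: max_span_vmax.
(* A second induction, now over [T], shows that the span is closed under scaling by [a]. *)
pose P y := max_span T (a *: y).
apply: (@max_span_ind _ _ T P) => [|u v|b y b0 Ty]; rewrite /P.
- by rewrite scaler0; exact: max_span0.
- by rewrite scaler_vmax//; exact: max_span_vmax.
- by rewrite scalerA; apply: max_span_scale => //; rewrite mulr_ge0.
Qed.

Lemma sub_max_span {R : realType} {n : nat} {T : set 'rV[R]_n} :
  T `<=` @nonneg_orthant R n -> T `<=` max_span T.
Proof. by move=> T0 x Tx; rewrite -[x]scale1r; exact: max_span_scale. Qed.

Lemma max_span_mono {R : realType} {n : nat} {S T : set 'rV[R]_n} :
  T `<=` @nonneg_orthant R n -> S `<=` T -> max_span S `<=` max_span T.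
Proof.
by move=> T0 ST; apply: max_span_sub => // x /ST; exact: sub_max_span.
Qed.

(** Isolates the contribution of one generator; by induction, the coefficients of [x] combine by
    maximum and the remainders by [vmax]. *)
Lemma max_span_split {R : realType} {n : nat} {S : set 'rV[R]_n} {x y} :
  S `<=` @nonneg_orthant R n -> S x -> max_span S y ->
  exists a v, [/\ 0 <= a, max_span (S `\ x) v & y = vmax (a *: x) v].
Proof.
move=> S0 Sx; have x0 := S0 x Sx.
have S'0 : S `\ x `<=` @nonneg_orthant R n by move=> z [/S0].
apply: (@max_span_ind _ _ _ (fun y => exists a v,
  [/\ 0 <= a, max_span (S `\ x) v & y = vmax (a *: x) v])).
- exists 0, 0; split=> //; first exact: max_span0.
  by rewrite scale0r vmaxr0//; exact: orthant0.
- move=> _ _ [a [v [a0 sv ->]]] [b [w [b0 sw ->]]].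
  exists (Num.max a b), (vmax v w); split; first by rewrite le_max a0.
    exact: max_span_vmax.
  by rewrite vmaxCA4 scale_max.
move=> a z a0 Sz; have [zx|zx] := eqVneq z x.
  exists a, 0; split=> //; first exact: max_span0.
  by rewrite zx vmaxr0//; exact: scale_ge0.
exists 0, (a *: z); split=> //.
  by apply: max_span_scale => //; split=> //; exact/eqP.
apply/rowP => i; rewrite vmaxE scale0r [X in Num.max X _]mxE max_r//.
by apply: scale_ge0 => //; exact: S0.
Qed.

(** * Extremals, scaled vectors and generating sets *)

Lemma extremal_max_span {R : realType} {n : nat} {K T : set 'rV[R]_n} {u} :
  max_cone K -> T `<=` K -> extremal K u -> u <> 0 -> max_span T u ->
  exists a x, [/\ 0 <= a, T x & u = a *: x].
Proof.
move=> hK TK [Ku extu] u0 su.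
have K0 : K 0 by case: hK => _ _ /(_ 0 _ (lexx _) Ku); rewrite scale0r.
(* Membership in [K] is carried along because extremality only speaks of decompositions within
   [K]. *)
pose P y := K y /\ (u = y -> exists a x, [/\ 0 <= a, T x & u = a *: x]).
suff [_] : P u by apply.
apply: max_span_ind su; rewrite /P.
- by split=> // /u0.
- move=> v w [Kv Pv] [Kw Pw]; split; first by case: hK => _ + _; apply.
  by move/(extu _ _ Kv Kw) => -[/Pv|/Pw].
- move=> a x a0 Tx; split; last by move=> ->; exists a, x.
  by case: hK => _ _; apply=> //; exact: TK.
Qed.

Lemma scaled_neq0 {R : realType} {n : nat} {N : 'rV[R]_n -> R} {x} :
  is_norm N -> scaled N x -> x <> 0.
Proof.
move=> hN [_ Nx] x0; have := is_normZ hN 0 0.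
by rewrite scale0r -x0 Nx normr0 mul0r => /eqP; rewrite oner_eq0.
Qed.

Lemma scaled_scale_inj {R : realType} {n : nat} {N : 'rV[R]_n -> R}
    {a x y} :
  is_norm N -> scaled N x -> scaled N y -> 0 <= a -> x = a *: y -> x = y.
Proof.
move=> hN [_ Nx] [_ Ny] a0 xy; have := is_normZ hN a y.
by rewrite -xy Nx Ny mulr1 ger0_norm// => a1; rewrite xy -a1 scale1r.
Qed.

(** With [T] the whole generating set this puts every scaled extremal in it; with [T] the set
    deprived of [x] it gives independence. *)
Lemma scaled_extremal_in {R : realType} {n : nat} {N : 'rV[R]_n -> R}
    {K T : set 'rV[R]_n} {x} :
  is_norm N -> max_cone K -> T `<=` K -> (forall y, T y -> scaled N y) ->
  scaled_extremals N K x -> max_span T x -> T x.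
Proof.
move=> hN hK TK TN [ex sx] /(extremal_max_span hK TK ex (scaled_neq0 hN sx)).
case=> a [y [a0 Ty xy]].
by rewrite (scaled_scale_inj hN sx (TN y Ty) a0 xy).
Qed.

Lemma vle_scale1 {R : realType} {n : nat} {a : R} {x : 'rV[R]_n} :
  nonneg_orthant x -> x <> 0 -> vle (a *: x) x -> a <= 1.
Proof.
move=> x0 xn0 ax; have [i xi] : exists i, x 0 i != 0.
  apply: contrapT => nx; apply: xn0; apply/rowP => i; rewrite mxE.
  by apply/eqP/negPn/negP => xi; apply: nx; exists i.
have xi0 : 0 < x 0 i by rewrite lt_def xi x0.
by have := ax i; rewrite mxE ger_pMl.
Qed.

(** Where [x] is positive, [a *: x] is strictly smaller and the maximum comes from [v]; where [x]
    vanishes, so does [a *: x], and [v] is nonnegative. *)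
Lemma vmax_scale_cancel {R : realType} {n : nat} (a : R) (x v : 'rV[R]_n) :
  nonneg_orthant x -> nonneg_orthant v -> a < 1 -> x = vmax (a *: x) v -> x = v.
Proof.
move=> x0 v0 a1 xv; apply/rowP => i.
have := congr1 (fun u : 'rV_n => u 0 i) xv; rewrite vmaxE mxE.
have [xi|xi] := eqVneq (x 0 i) 0; first by rewrite xi mulr0 max_r.
have xi0 : 0 < x 0 i by rewrite lt_def xi x0.
have : a * x 0 i < x 0 i by rewrite gtr_pMl.
case: (leP (a * x 0 i) (v 0 i)) => // _ axx xE.
by move: axx; rewrite -xE ltxx.
Qed.

Lemma basis_extremal {R : realType} {n : nat} {K S : set 'rV[R]_n} {x} :
  max_cone K -> S `<=` K -> max_basis S K -> S x -> x <> 0 -> extremal K x.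
Proof.
move=> hK SK [indS genS] Sx xn0; split=> [|v w]; first exact: SK.
have K0 : K `<=` @nonneg_orthant R n by case: hK.
have S0 : S `<=` @nonneg_orthant R n by move=> z /SK/K0.
have S'0 : S `\ x `<=` @nonneg_orthant R n by move=> z [/S0].
have x0 := S0 x Sx; rewrite -genS.
move=> /(max_span_split S0 Sx)[a [v' [a0 sv vE]]].
move=> /(max_span_split S0 Sx)[b [w' [b0 sw wE]]] xE.
have [vx wx] : vle v x /\ vle w x by apply/vmax_le; rewrite -xE => i.
have /vmax_le[ax _] : vle (vmax (a *: x) v') x by rewrite -vE.
have /vmax_le[bx _] : vle (vmax (b *: x) w') x by rewrite -wE.
have [a1|a1] := eqVneq a 1.
  left; apply: vle_anti => // i.
  by rewrite vE a1 scale1r vmaxE le_max lexx.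
have [b1|b1] := eqVneq b 1.
  right; apply: vle_anti => // i.
  by rewrite wE b1 scale1r vmaxE le_max lexx.
have svw := max_span_vmax S'0 sv sw.
case: indS; exists x => //.
(* Regrouping gives [x] as the [vmax] of [Num.max a b *: x] and [vmax v' w']; as [a] and [b] are
   below [1], the first part cancels. *)
suff xvw : x = vmax v' w' by rewrite [X in max_span _ X]xvw.
apply: (@vmax_scale_cancel _ _ (Num.max a b)) => //.
- exact: max_span_ge0 svw.
- by rewrite gt_max !lt_neqAle a1 b1 !(vle_scale1 x0 xn0).
by rewrite scale_max// vmaxCA4 -vE -wE.
Qed.

(** An element in the span of the others can be removed without changing the span, against
    minimality. *)
Lemma minimal_generators_independent {R : realType} {n : nat}
    (S K : set 'rV[R]_n) :
  S `<=` @nonneg_orthant R n -> minimal_generators S K -> independent S.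
Proof.
move=> S0 [genS minS] [x Sx sx].
have S'0 : S `\ x `<=` @nonneg_orthant R n by move=> z [/S0].
suff genS' : generates (S `\ x) K.
  have /predeqP/(_ x)[_ /(_ Sx)[_]] : S `\ x = S by apply: minS => // y [].
  exact.
rewrite /generates -genS; apply/seteqP; split.
  by apply: max_span_mono => // y [].
apply: max_span_sub => // y Sy; have [->//|yx] := eqVneq y x.
by apply: sub_max_span => //; split=> //; exact/eqP.
Qed.

(** If a generating [T] inside [S] missed [x], then [x] would lie in the span of [T], hence in that
    of the other elements of [S]. *)
Lemma basis_minimal_generators {R : realType} {n : nat} (S K : set 'rV[R]_n) :
  S `<=` @nonneg_orthant R n -> max_basis S K -> minimal_generators S K.
Proof.
move=> S0 [indS genS]; split=> // T TS genT.
apply/seteqP; split=> // x Sx; apply: contrapT => nTx.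
apply: indS; exists x => //.
have sx : max_span T x by rewrite genT -genS; exact: sub_max_span.
apply: max_span_mono sx => [z [/S0//]|y Ty].
by split; [exact: TS|move=> yx; apply: nTx; rewrite -yx].
Qed.

Theorem theorem18 (R : realType) (n : nat) (N : 'rV[R]_n -> R)
    (K S : set 'rV[R]_n) (hN : is_norm N) (hK : max_cone K)
    (hSK : S `<=` K) (hS : forall x, S x -> scaled N x) :
  [<-> minimal_generators S K;
       S = scaled_extremals N K /\ generates S K;
       max_basis S K].
Proof.
have S0 : S `<=` @nonneg_orthant R n by move=> x /hS[].
tfae.
- move=> minS; have genS := minS.1; split=> //.
  (* Extremality of the elements of [S] is obtained by first passing from minimality to
     independence. *)
  have bS : max_basis S K.
    by split=> //; exact: minimal_generators_independent minS.
  apply/seteqP; split=> x => [Sx|ex].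
    split; last exact: hS.
    exact: (basis_extremal hK hSK bS Sx (scaled_neq0 hN (hS x Sx))).
  apply: (scaled_extremal_in hN hK hSK hS ex).
  by rewrite genS; case: ex => -[].
- move=> [SE genS]; split=> // -[x Sx sx].
  suff [_ /(_ erefl)] : (S `\ x) x by [].
  apply: (scaled_extremal_in hN hK _ _ _ sx).
  + by move=> y [/hSK].
  + by move=> y [/hS].
  + by rewrite -SE.
- exact: basis_minimal_generators.
Qed.
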